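(* Let $\mathbb{F}$ be either the field of real numbers or a finite field in which $-3$ is a quadratic non-residue. The polynomial $S_4^2(x_1,x_2,x_3,x_4)=x_1x_2+x_1x_3+x_1x_4+x_2x_3+x_2x_4+x_3x_4$ is not expressible as a read-once determinant over $\mathbb{F}$; that is, there is no matrix $M$ (of any size) with entries in $\{x_1,x_2,x_3,x_4\}\cup\mathbb{F}$, in which each variable occurs in at most one position, such that $\det(M)=S_4^2$. *)

(* Defs.v *)
From mathcomp Require Import all_boot all_order all_algebra.
From mathcomp Require Import reals.
From mathcomp Require Import mpoly.

Set Implicit Arguments.
Unset Strict Implicit.
Unset Printing Implicit Defensive.

Import GRing.Theory.
Local Open Scope ring_scope.

Definition read_once (F : fieldType) (k n : nat) (M : 'M[{mpoly F[k]}]_n)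
    : Prop :=
  (forall i j, (exists v : 'I_k, M i j = 'X_v) \/ (exists c : F, M i j = c%:MP))
  /\ (forall (v : 'I_k) i j i' j',
        M i j = 'X_v -> M i' j' = 'X_v -> i = i' /\ j = j').

Definition read_once_determinant (F : fieldType) (k : nat) (f : {mpoly F[k]})
    : Prop :=
  exists (n : nat) (M : 'M[{mpoly F[k]}]_n), read_once M /\ \det M = f.

(* The ordinals 0, 1, 2, 3 : 'I_4 stand for the indices 1, 2, 3, 4. *)
Definition S42 (F : fieldType) : {mpoly F[4]} :=
  'X_0 * 'X_1 + 'X_0 * 'X_2 + 'X_0 * 'X_3
  + 'X_1 * 'X_2 + 'X_1 * 'X_3 + 'X_2 * 'X_3.

(* 0 is a square, so in characteristic 3 the element -3 = 0 does not satisfy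
   this predicate. *)
Definition quadratic_nonresidue (F : fieldType) (a : F) : Prop :=
  ~ exists y : F, y ^+ 2 = a.

(* Main.v *)
(* A read-once matrix is an affine pencil C + \sum_w x_w p_w q_w with rank one
   coefficients p_w q_w. For such a pencil the 2x2 minors of the adjugate show
   that f_10 f_01 - f_00 f_11, where f_ab is the value of the determinant at
   x_1 = a, x_2 = b, is a product of two polynomials of degree at most 1 in each
   of the other variables. For S_4^2 at x_3 = X, x_4 = 1 that quantity is
   X^2 + X + 1; a factor of degree 1 has a root y, and (2y + 1)^2 = -3. *)
Require Import Defs.
From mathcomp Require Import all_boot all_order all_algebra.
From mathcomp Require Import reals.
From mathcomp Require Import mpoly.
From mathcomp Require Import ring zify.
Import Order.TTheory GRing.Theory Num.Theory.

Local Open Scope ring_scope.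

(** Matrix determinant lemma with denominators cleared, so that [A] need not be invertible. The
    block matrix with rows [A], [- U] and [V], [1] is reduced in two ways: by columns, and by rows
    using [\adj A], where the factor [\det A] on the lower rows yields the power [k]. *)
Lemma det_add_mulmx {R : comNzRingType} {n k : nat} (A : 'M[R]_n)
    (U : 'M[R]_(n, k)) (V : 'M[R]_(k, n)) :
  \det A ^+ k * \det (A + U *m V) =
  \det A * \det ((\det A)%:M + V *m \adj A *m U).
Proof.
have detB : \det (block_mx A (- U) V 1%:M) = \det (A + U *m V).
  have /(congr1 determinant) :
      block_mx A (- U) V 1%:M *m block_mx 1%:M 0 (- V) 1%:M =
      block_mx (A + U *m V) (- U) 0 1%:M.
    rewrite mulmx_block !mulmx1 !mul1mx !mulmx0 !add0r mulNmx mulmxN opprK.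
    by rewrite subrr.
  by rewrite det_mulmx det_lblock det_ublock !det1 !mulr1.
have /(congr1 determinant) :
    block_mx 1%:M 0 (- (V *m \adj A)) (\det A)%:M *m block_mx A (- U) V 1%:M =
    block_mx A (- U) 0 ((\det A)%:M + V *m \adj A *m U).
  rewrite mulmx_block !mul1mx !mul0mx !addr0 mulmx1 !mulNmx mulmxN opprK.
  rewrite -[V *m \adj A *m A]mulmxA mul_adj_mx mul_mx_scalar mul_scalar_mx addNr.
  by rewrite [_ *m U + _]addrC.
by rewrite det_mulmx det_lblock det_ublock det1 det_scalar mul1r detB.
Qed.

Lemma det_add_col_row {R : idomainType} {n : nat} (A : 'M[R]_n)
    (p : 'cV[R]_n) (q : 'rV[R]_n) :
  \det (A + p *m q) = \det A + (q *m \adj A *m p) 0 0.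
Proof.
(* The rank one case of [det_add_mulmx] for [A + 'X], whose determinant is
   monic and can be cancelled, evaluated at ['X = 0]. *)
pose ev : {rmorphism {poly R} -> R} := horner_eval 0.
pose B := char_poly_mx (- A).
have B0 : map_mx ev B = A.
  apply/matrixP => i j; rewrite !mxE /= /horner_eval.
  by rewrite hornerD hornerN hornerMn hornerX !hornerC mul0rn add0r opprK.
have polyC0 (m l : nat) (C : 'M[R]_(m, l)) :
    map_mx ev (map_mx polyC C) = C.
  by apply/matrixP => i j; rewrite !mxE /= /horner_eval hornerC.
have nzB : \det B != 0 by exact: monic_neq0 (char_poly_monic _).
have := det_add_mulmx B (map_mx polyC p) (map_mx polyC q).
rewrite expr1 => /(mulfI nzB) /(congr1 ev).
rewrite -det_map_mx map_mxD map_mxM B0 !polyC0 => ->.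
rewrite -det_map_mx map_mxD !map_mxM map_scalar_mx -det_map_mx map_mx_adj B0 !polyC0.
by rewrite det_mx11 !mxE eqxx mulr1n.
Qed.

Lemma det_block_mx11 {R : comNzRingType} (a b c d : 'M[R]_1) :
  \det (block_mx a b c d) = a 0 0 * d 0 0 - b 0 0 * c 0 0.
Proof.
rewrite -(block_mxEul a b c d) -(block_mxEur a b c d).
rewrite -(block_mxEdl a b c d) -(block_mxEdr a b c d).
move: (block_mx a b c d) => A.
rewrite (expand_det_row _ (lshift 1 0)) !big_ord_recl big_ord0 addr0 /cofactor.
rewrite !det_mx11 !mxE /= expr0 expr1 mul1r mulN1r mulrN.
by congr (A _ _ * A _ _ - A _ _ * A _ _); apply/val_inj.
Qed.

(** After cancelling one [\det N], the rank two update becomes a 2x2 determinant with entries built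
    from [q_i *m \adj N *m p_j]. The left side keeps only its off-diagonal product, and each factor
    is a rank one update. *)
Lemma det_add_two_col_row {R : idomainType} {n : nat} (N : 'M[R]_n)
    (p1 p2 : 'cV[R]_n) (q1 q2 : 'rV[R]_n) (nzN : \det N != 0) :
  \det (N + p1 *m q1) * \det (N + p2 *m q2)
    - \det N * \det (N + p1 *m q1 + p2 *m q2) =
  (\det (N + p2 *m q1) - \det N) * (\det (N + p1 *m q2) - \det N).
Proof.
have := det_add_mulmx N (row_mx p1 p2) (col_mx q1 q2).
rewrite mul_row_col addrA expr2 -mulrA => /(mulfI nzN) ->.
rewrite mul_col_mx mul_col_row (scalar_mx_block 1 1) add_block_mx !add0r.
rewrite det_block_mx11 !det_add_col_row.
set a := q1 *m _ *m p1; set b := q1 *m _ *m p2.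
set c := q2 *m _ *m p1; set d := q2 *m _ *m p2.
rewrite !mxE eqxx mulr1n.
ring.
Qed.

Lemma size_det_affine {F : fieldType} {n : nat} (C : 'M[F]_n)
    (p : 'cV[F]_n) (q : 'rV[F]_n) :
  (size (\det (map_mx polyC C + 'X *: map_mx polyC (p *m q))) <= 2)%N.
Proof.
rewrite map_mxM scalemxAl det_add_col_row -scalemxAr mxE -map_mx_adj -!map_mxM.
rewrite det_map_mx mxE mulrC addrC.
by rewrite size_MXaddC; case: ifP => // _; rewrite ltnS size_polyC_leq1.
Qed.

Lemma read_once_entries {F : fieldType} {k n : nat} (M : 'M[{mpoly F[k]}]_n)
    (roM : read_once M) :
  exists (C : 'M[F]_n) (p : 'I_k -> 'cV[F]_n) (q : 'I_k -> 'rV[F]_n),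
    M = map_mx (@mpolyC k F) C
        + \sum_w 'X_w *: map_mx (@mpolyC k F) (p w *m q w).
Proof.
case: roM => varcstM injM.
(* Indicators of the row and the column holding ['X_w], zero if it is absent. By [injM] their
   product marks exactly that position. *)
pose p w : 'cV[F]_n := \col_i [exists j, M i j == 'X_w]%:R.
pose q w : 'rV[F]_n := \row_j [exists i, M i j == 'X_w]%:R.
have pqE w i j : (p w *m q w) i j = (M i j == 'X_w)%:R.
  rewrite mxE big_ord1 !mxE -natrM mulnb; congr (_%:R); congr nat_of_bool.
  apply/andP/idP => [[/existsP[j' /eqP Mij'] /existsP[i' /eqP Mi'j]]|Mij].
    by have [_ <-] := injM _ _ _ _ _ Mij' Mi'j; rewrite Mij'.
  by split; apply/existsP; [exists j | exists i].
exists (\matrix_(i, j) (M i j)@_0), p, q; apply/matrixP => i j.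
rewrite !mxE summxE.
under eq_bigr do rewrite mxE mxE pqE.
case: (varcstM i j) => [[v ->]|[c ->]].
  rewrite mcoeffX mnm1_eq0 add0r (bigD1 v) //= eqxx mulr1 big1 ?addr0 //.
  move=> w neq_wv; case: eqP => [|_]; last by rewrite mpolyC0 mulr0.
  move=> /(congr1 (mcoeff U_(v)%MM)); rewrite !mcoeffX eqxx eq_mnm1.
  by rewrite (negPf neq_wv) => /eqP; rewrite oner_eq0.
rewrite mcoeffC eqxx mulr1 big1 ?addr0 // => w _.
case: eqP => [|_]; last by rewrite mpolyC0 mulr0.
move=> /(congr1 (mcoeff U_(w)%MM)); rewrite mcoeffC mcoeffX eqxx.
by rewrite mnm1_eq0 mulr0 => /esym/eqP; rewrite oner_eq0.
Qed.

Local Notation P := (map_mx polyC).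

Lemma S42_not_read_once {F : fieldType} (hF : quadratic_nonresidue (- 3%:R : F)) :
  ~ read_once_determinant (S42 F).
Proof.
case=> n [M [/read_once_entries[C [p [q ->]]] detM]].
have sum4 (V : nmodType) (f : 'I_4 -> V) :
    \sum_w f w = f 3 + f 2 + f 0 + f 1.
  rewrite !big_ord_recl big_ord0 addr0 !addrA [RHS](AC (((1*1)*1)*1) (3*4*2*1))%AC.
  by congr (f _ + f _ + f _ + f _); apply/val_inj.
(* The pencil at x_1 = x_2 = 0, x_3 = X, x_4 = 1; below, [a] and [b] are the values of x_1 and
   x_2. *)
pose N := P (C + p 3 *m q 3) + 'X *: P (p 2 *m q 2).
have detN (a b : {poly F}) :
    \det (N + a *: (P (p 0) *m P (q 0)) + b *: (P (p 1) *m P (q 1))) =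
    a * b + (a + b) * ('X + 1) + 'X.
  pose v : 'I_4 -> {poly F} := tnth [tuple a; b; 'X; 1].
  pose ev : {rmorphism {mpoly F[4]} -> {poly F}} := mmap polyC v.
  have evX w : ev 'X_w = v w by rewrite /= mmapX mmap1U.
  have evC (A : 'M[F]_n) : map_mx ev (map_mx (@mpolyC 4 F) A) = P A.
    by apply/matrixP => i j; rewrite !mxE /= mmapC.
  have := congr1 ev detM; rewrite sum4 -det_map_mx !map_mxD !map_mxZ !evC.
  rewrite !addrA /S42 !rmorphD !rmorphM !evX.
  have -> : v 0 = a by [].
  have -> : v 1 = b by [].
  have -> : v 2 = 'X by [].
  have -> : v 3 = 1 by [].
  rewrite scale1r /N map_mxD !map_mxM => ->.
  ring.
pose A i j := \det (N + P (p i) *m P (q j)) - \det N.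
have sizeA i j : (size (A i j) <= 2)%N.
  rewrite (leq_trans (size_polyD _ _)) // geq_max size_polyN size_det_affine andbT.
  (* The term [p i *m q j] is free of ['X] and joins the constant part, so the coefficient of ['X]
     still has rank one. *)
  by rewrite -map_mxM addrAC -map_mxD size_det_affine.
have det0 : \det N = 'X.
  have := detN 0 0; rewrite !scale0r !addr0 => ->.
  by rewrite !mul0r !add0r.
have nzN : \det N != 0.
  by rewrite det0 polyX_eq0.
(* Here f_00 = X, f_10 = f_01 = 2X + 1 and f_11 = 3X + 3. *)
have AA : A 1 0 * A 0 1 = 'X^2 + 'X + 1.
  rewrite -det_add_two_col_row //.
  have := detN 1 0; rewrite scale1r scale0r addr0 => ->.
  have := detN 0 1; rewrite scale1r scale0r addr0 => ->.
  have := detN 1 1; rewrite !scale1r => ->.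
  rewrite det0; ring.
(* Two factors of degree at most 1 with a product of degree 2 both have degree exactly 1. *)
have : size (A 1 0) = 2.
  have sizeAA : size (A 1 0 * A 0 1) = 3.
    have -> : A 1 0 * A 0 1 = ('X + 1%:P) * 'X + 1%:P by rewrite AA; ring.
    by rewrite size_MXaddC size_XaddC oner_eq0 andbF.
  apply/eqP; rewrite eqn_leq sizeA /=.
  have := size_polyMleq (A 1 0) (A 0 1); rewrite sizeAA.
  move: (sizeA 0 1); move: (size _) (size _) => m l; lia.
case/poly2_root => y /rootP Ay; apply: hF; exists (2 * y + 1).
have := congr1 (horner^~ y) AA.
rewrite hornerM Ay mul0r !hornerE => y0.
transitivity (4 * (y ^+ 2 + y + 1) - 3); first ring.
by rewrite -y0 mulr0 sub0r.
Qed.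

Theorem theorem4 :
  (forall R : realType, ~ read_once_determinant (S42 R)) /\
  (forall F : finFieldType,
     quadratic_nonresidue (- 3%:R : F) -> ~ read_once_determinant (S42 F)).
Proof.
split=> [R|F]; last exact: S42_not_read_once.
apply: S42_not_read_once => -[y y2].
by have := sqr_ge0 y; rewrite y2 oppr_ge0 lern0.
Qed.
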